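(* Let $\mathcal{S}$ be a stochastic system as described in the context, let $\mathcal{M}_{\mathbb{I}}=(S,s_I,Act,\mathcal{P},\mathcal{Y},L)$ be an IMDP abstraction of $\mathcal{S}$ as described in the context which is label-preserving, i.e. $L(\mathcal{T}(x))=g(x)$ for all $x\in\mathcal{X}$. Let $\varphi\subseteq(2^{\mathcal{Y}})^{\mathbb{N}}$ be a (measurable) specification and let $\sigma=(\sigma_0,\sigma_1,\dots)$ be a Markovian scheduler of $\mathcal{M}_{\mathbb{I}}$. Let $\pi=(\pi_0,\pi_1,\dots)$ be a policy for $\mathcal{S}$ that is refined from $\sigma$ through the interface functions, i.e. for all $k\in\mathbb{N}$ and all $x_k\in\mathcal{X}$, $$\pi_k(x_k)=I_{s,a}(x_k),\qquad s=\mathcal{T}(x_k),\ a=\sigma_k(s).$$ Then $$\Pr^{\mathcal{S}}_{\pi}(\varphi)\;\ge\;\min_{P\in\mathcal{P}}\ \Pr^{\mathcal{M}_{\mathbb{I}}}_{\sigma,P}\{(L(s_0),L(s_1),\dots)\in\varphi\}.$$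
   Context: System: $x_{k+1}=f(x_k,u_k,\eta_k)$, $y_k=g(x_k)$, $k\in\mathbb{N}$, with state $x_k\in\mathcal{X}\subset\mathbb{R}^n$ ($\mathcal{X}$ compact), initial state $x_0=x_I$, input $u_k\in\mathcal{U}\subseteq\mathbb{R}^m$, $(\eta_k)_{k}$ i.i.d. random variables $\eta_k:\Omega\to\mathcal{W}\subseteq\mathbb{R}^p$ on a probability space $(\Omega,\mathcal{F},\mathbb{P})$, $f:\mathcal{X}\times\mathcal{U}\times\mathcal{W}\to\mathcal{X}$ measurable (Lipschitz), and labelling $g:\mathcal{X}\to 2^{\mathcal{Y}}$ over a finite label set $\mathcal{Y}$. A (Markovian) policy is $\pi=(\pi_0,\pi_1,\dots)$ with measurable $\pi_k:\mathbb{R}^n\to\mathcal{U}$; it induces a Markov process on trajectories $x_{k+1}=f(x_k,\pi_k(x_k),\eta_k)$ and thus a probability measure $\mathbb{P}^{\mathcal{S}}_\pi$ on traces $(y_0,y_1,\dots)\in(2^{\mathcal{Y}})^{\mathbb{N}}$; $\Pr^{\mathcal{S}}_\pi(\varphi):=\mathbb{P}^{\mathcal{S}}_\pi\{(y_0,y_1,\dots)\in\varphi\}$. IMDP: a tuple $(S,s_I,Act,\mathcal{P},\mathcal{Y},L)$ with finite state set $S$, initial state $s_I$, finite action set $Act$ with enabled actions $Act(s)\subseteq Act$, labelling $L:S\to 2^{\mathcal{Y}}$, and for $s\in S$, $a\in Act(s)$, $\mathcal{P}(s,a)=\{\mu\in\mathcal{D}(S):\mu(s')\in[\check p(s,a,s'),\hat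 p(s,a,s')]\ \forall s'\in S\}$. A Markovian scheduler is $\sigma=(\sigma_0,\sigma_1,\dots)$ with $\sigma_k:S\to Act$, $\sigma_k(s)\in Act(s)$. An adversary $P\in\mathcal{P}$ chooses, each time a pair $(s,a)$ is visited, some distribution in $\mathcal{P}(s,a)$ (dynamic uncertainty; possibly different at each visit). Fixing $\sigma$ and $P$ gives a Markov chain with measure $\mathbb{P}^{\mathcal{M}_{\mathbb{I}}}_{\sigma,P}$ and $\Pr^{\mathcal{M}_{\mathbb{I}}}_{\sigma,P}$ denotes probabilities of sets of label traces $(L(s_0),L(s_1),\dots)$. Abstraction: $\mathcal{X}$ is partitioned into disjoint convex polytopes $R_1,\dots,R_v$ covering $\mathcal{X}$, and $R_\star=\mathbb{R}^n\setminus\mathcal{X}$; $S=\{s_1,\dots,s_v\}\cup\{s_\star\}$; the abstraction map $\mathcal{T}:\mathbb{R}^n\to S$ satisfies $\mathcal{T}(x)=s_i\iff x\in R_i$ (and $\mathcal{T}(x)=s_\star\iff x\in R_\star$), with preimage $\mathcal{T}^{-1}(s)$ the corresponding region; $s_I=\mathcal{T}(x_I)$. The input space is partitioned into disjoint sets $\bar U_1,\dots,\bar U_J$ with representatives $\bar u_j\in\bar U_j$, $\bar{\mathbf u}=\{\bar u_1,\dots,\bar u_J\}$. Each pair $(s,a)$ with $a\in Act(s)$ has an interface function $I_{s,a}:\mathcal{T}^{-1}(s)\to\bar{\mathbf u}$. For $x\in\mathcal{X}$, compact $X'$, and action $a$, $\psi(x,X',a):=\mathbb{P}\{\omega: f(x,I_{\mathcal{T}(x),a}(x),\eta(\omega))\in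 X'\}$, and the interval bounds are $\check p(s,a,s')=\min_{x\in\mathcal{T}^{-1}(s)}\psi(x,\mathcal{T}^{-1}(s'),a)$, $\hat p(s,a,s')=\max_{x\in\mathcal{T}^{-1}(s)}\psi(x,\mathcal{T}^{-1}(s'),a)$. *)

(* Defs.v *)
From mathcomp Require Import all_boot all_order all_algebra.
From mathcomp Require Import all_classical all_reals all_analysis.
Import Order.TTheory GRing.Theory Num.Theory.
Import numFieldNormedType.Exports.

Set Implicit Arguments.
Unset Strict Implicit.
Unset Printing Implicit Defensive.

Local Open Scope classical_set_scope.
Local Open Scope ring_scope.

Notation BorelRV R n := (g_sigma_algebraType (@open 'rV[R]_n)).

Definition path_cyl (T : Type) : set (set (nat -> T)) :=
  [set A | exists (k : nat) (a : T), A = [set w | w k = a]].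
(* Paths over the IMDP state space S = {s_1,...,s_v} u {s_star}, encoded as
   option 'I_v (Some i = s_(i+1), None = s_star). *)
Notation path_space v := (g_sigma_algebraType (@path_cyl (option 'I_v))).

(* (eta_k)_k is an i.i.d. sequence of random variables Omega -> W, W a subset of R^p.
   Mutual independence is stated as the product rule for every finite prefix of
   indices (taking B i = setT for unused indices gives every finite subfamily). *)
Definition iid_noise d (Omega : measurableType d) (R : realType)
    (P : probability Omega R) (p : nat) (W : set 'rV[R]_p)
    (eta : nat -> Omega -> 'rV[R]_p) : Prop :=
  [/\ (forall k, measurable_fun setT (eta k : Omega -> BorelRV R p)),
      (forall k w, W (eta k w)),
      (forall k (B : set (BorelRV R p)), measurable B ->
          P (eta k @^-1` B) = P (eta 0%N @^-1` B)) &
      (forall (k : nat) (B : nat -> set (BorelRV R p)),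
          (forall i, measurable (B i)) ->
          P [set w | forall i, (i < k)%N -> B i (eta i w)] =
          (\prod_(i < k) P (eta i @^-1` B i))%E)].

Definition lipschitz3 (R : realType) (n m p : nat)
    (X : set 'rV[R]_n) (U : set 'rV[R]_m) (W : set 'rV[R]_p)
    (f : 'rV[R]_n -> 'rV[R]_m -> 'rV[R]_p -> 'rV[R]_n) : Prop :=
  exists K : R, forall x x' u u' w w', X x -> X x' -> U u -> U u' -> W w -> W w' ->
    `|f x u w - f x' u' w'| <= K * (`|x - x'| + `|u - u'| + `|w - w'|).

Definition convex_polytope (R : realType) (n : nat) (A : set 'rV[R]_n) : Prop :=
  bounded_set A /\
  exists (k : nat) (a : 'I_k -> 'rV[R]_n) (b : 'I_k -> R) (strict : 'I_k -> bool),
    A = [set x | forall j : 'I_k,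
           if strict j then \sum_(i < n) a j 0 i * x 0 i < b j
           else \sum_(i < n) a j 0 i * x 0 i <= b j].

Fixpoint traj (Omega : Type) (R : realType) (n m p : nat)
    (f : 'rV[R]_n -> 'rV[R]_m -> 'rV[R]_p -> 'rV[R]_n)
    (pi : nat -> 'rV[R]_n -> 'rV[R]_m) (eta : nat -> Omega -> 'rV[R]_p)
    (xI : 'rV[R]_n) (k : nat) (w : Omega) : 'rV[R]_n :=
  match k with
  | 0 => xI
  | k'.+1 => let x := traj f pi eta xI k' w in f x (pi k' x) (eta k' w)
  end.

Definition psi d (Omega : measurableType d) (R : realType) (P : probability Omega R)
    (n m p : nat) (S Act : Type)
    (f : 'rV[R]_n -> 'rV[R]_m -> 'rV[R]_p -> 'rV[R]_n) (eta0 : Omega -> 'rV[R]_p)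
    (T : 'rV[R]_n -> S) (I : S -> Act -> 'rV[R]_n -> 'rV[R]_m)
    (x : 'rV[R]_n) (X' : set 'rV[R]_n) (a : Act) : \bar R :=
  P [set w | X' (f x (I (T x) a x) (eta0 w))].

Definition is_min_on (T : Type) (R : realType) (A : set T) (F : T -> \bar R) (v : \bar R) :=
  (exists2 x, A x & F x = v) /\ (forall x, A x -> (v <= F x)%E).
Definition is_max_on (T : Type) (R : realType) (A : set T) (F : T -> \bar R) (v : \bar R) :=
  (exists2 x, A x & F x = v) /\ (forall x, A x -> (F x <= v)%E).

Definition in_Pset (S : finType) (Act : Type) (R : realType)
    (plo phi : S -> Act -> S -> R) (s : S) (a : Act) (mu : S -> R) : Prop :=
  [/\ forall s', 0 <= mu s', \sum_(s' : S) mu s' = 1 &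
      forall s', plo s a s' <= mu s' <= phi s a s'].

(* An adversary: at each step, given the history of visited states, the current
   state s and action a, it chooses a distribution in P(s,a) (history dependent,
   hence possibly different at each visit of (s,a)). *)
Definition adversary (S Act : finType) (R : realType)
    (enabled : S -> {set Act}) (plo phi : S -> Act -> S -> R)
    (Adv : seq S -> S -> Act -> S -> R) : Prop :=
  forall h s a, a \in enabled s -> in_Pset plo phi s a (Adv h s a).

Definition imdp_path_law (v : nat) (Act : finType) (R : realType) (sI : option 'I_v)
    (sigma : nat -> option 'I_v -> Act) (Adv : seq (option 'I_v) -> option 'I_v -> Act -> option 'I_v -> R)
    (mu : probability (path_space v) R) : Prop :=
  forall (k : nat) (h : nat -> option 'I_v),
    mu [set w : path_space v | forall i, (i <= k)%N -> w i = h i] =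
    ((if h 0%N == sI then 1 else 0) *
     \prod_(i < k) Adv [seq h j | j <- iota 0 i] (h i) (sigma i (h i)) (h i.+1))%:E.

Definition imdp_values (v : nat) (Act Y : finType) (R : realType) (sI : option 'I_v)
    (enabled : option 'I_v -> {set Act}) (plo phi : option 'I_v -> Act -> option 'I_v -> R)
    (L : option 'I_v -> {set Y}) (sigma : nat -> option 'I_v -> Act)
    (spec : set (nat -> {set Y})) : set (\bar R) :=
  [set r | exists (Adv : seq (option 'I_v) -> option 'I_v -> Act -> option 'I_v -> R)
                  (mu : probability (path_space v) R),
      [/\ adversary enabled plo phi Adv, imdp_path_law sI sigma Adv mu &
          r = mu [set w : path_space v | spec (fun k => L (w k))]]].

(* Main.v *)
Require Import Defs.
From HB Require Import structures.
From mathcomp Require Import all_boot all_order all_algebra.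
From mathcomp Require Import all_classical all_reals all_analysis.
From mathcomp Require Import measurable_realfun.
From mathcomp Require Import ring lra.
Import Order.TTheory GRing.Theory Num.Theory.
Import numFieldNormedType.Exports.
Local Open Scope classical_set_scope.
Local Open Scope ring_scope.

(** Let the adversary play the conditional law of the abstract process
    [T (x_k)] given its past, so that the induced Markov chain has exactly the
    law of [(T (x_k))_k], and [L (T (x_k)) = g (x_k)] makes the two probabilities
    of the specification equal: the infimum is bounded by a value it ranges over.
    The choice is admissible because [x_k] together with the abstract history is
    independent of [eta_k]: by Fubini, the conditional probability of moving from
    [s] to [s'] is an average of [psi] over points of the region of [s], hence lies
    between the minimum and the maximum of [psi] there. On histories of
    probability zero, any admissible distribution is played. *)

(** * Independence and integration with one variable frozen *)

Lemma measurable_preimageT {d d'} {T1 : measurableType d} {T2 : measurableType d'}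
  (f : T1 -> T2) (B : set T2) :
  measurable_fun setT f -> measurable B -> measurable (f @^-1` B).
Proof. by move=> mf mB; rewrite -[X in measurable X]setTI; exact: mf. Qed.

Section law_on.
Context {d d'} {Om : measurableType d} {E : measurableType d'} {R : realType}.
Variables (P : probability Om R) (A : set Om) (Z : Om -> E).
Hypotheses (mA : measurable A) (mZ : measurable_fun setT Z).

(* The two proofs are arguments only so that the measure instance can be inferred. *)
Definition law_on of measurable A & measurable_fun setT Z : set E -> \bar R :=
  fun C => P (A `&` Z @^-1` C).

Local Notation law := (law_on mA mZ).

Let law_on0 : law set0 = 0%E.
Proof. by rewrite /law_on preimage_set0 setI0 measure0. Qed.

Let law_on_ge0 C : (0 <= law C)%E.
Proof. exact: measure_ge0. Qed.

Let law_on_sigma_additive : semi_sigma_additive law.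
Proof.
move=> F mF tF mUF; rewrite /law_on preimage_bigcup setI_bigcupr.
apply: measure_semi_sigma_additive.
- by move=> n; apply: measurableI => //; exact: measurable_preimageT.
- apply/trivIsetP => i j _ _ ij; rewrite setIACA setIid -preimage_setI.
  by move/trivIsetP : tF => /(_ i j Logic.I Logic.I ij) ->; rewrite preimage_set0 setI0.
- rewrite -setI_bigcupr -preimage_bigcup; apply: measurableI => //; exact: measurable_preimageT.
Qed.

HB.instance Definition _ := isMeasure.Build _ _ _ law
  law_on0 law_on_ge0 law_on_sigma_additive.

Let law_on_finite : fin_num_fun law.
Proof.
move=> C mC; rewrite /law_on fin_num_measure//.
by apply: measurableI => //; exact: measurable_preimageT.
Qed.

HB.instance Definition _ := @Measure_isFinite.Build _ _ _ law law_on_finite.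

End law_on.

Section freezing.
Local Open Scope ereal_scope.
Context {d d1 d2} {Om : measurableType d} {T1 : measurableType d1}
  {T2 : measurableType d2} {R : realType}.
Variables (P : probability Om R) (A F : set Om) (Z : Om -> T1) (V : Om -> T2).
Hypotheses (mA : measurable A) (mF : measurable F).
Hypotheses (mZ : measurable_fun setT Z) (mV : measurable_fun setT V).
Hypothesis indepZ : forall C B, measurable C -> measurable B ->
  P (A `&` Z @^-1` C `&` (F `&` V @^-1` B)) =
  P (A `&` Z @^-1` C) * P (F `&` V @^-1` B).
Hypothesis indepV : forall B, measurable B ->
  P (F `&` V @^-1` B) = P F * P (V @^-1` B).

Local Notation ZV := (fun w => (Z w, V w)).

Let mZV : measurable_fun setT ZV.
Proof. exact: measurable_fun_pair. Qed.

(** By [indepZ], the law of the pair on the intersection of [A] and [F] factorises on rectangles, so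
    by uniqueness it is a product measure. Slicing [D] along [Z] gives an integral, and [indepV]
    pulls [P F] out of every slice. *)
Lemma indep_pair_integral D : measurable D ->
  P (A `&` F `&` ZV @^-1` D) =
  P F * \int[law_on P A Z mA mZ]_x P (V @^-1` xsection D x).
Proof.
move=> mD.
have mAF : measurable (A `&` F) by exact: measurableI.
have PF_fin : P F \is a fin_num by exact: fin_num_measure.
have <- : (law_on P A Z mA mZ \x law_on P F V mF mV) D = P (A `&` F `&` ZV @^-1` D).
  rewrite (@product_measure_unique _ _ _ _ _ _ _ (law_on P _ _ mAF mZV))//.
  move=> B C mB mC /=; rewrite /law_on -indepZ//; congr (P _).
  by apply/seteqP; split => w /= [[? ?] [? ?]].
rewrite /product_measure1 -ge0_integralZl//=.
- by apply: eq_integral => x _; rewrite /law_on indepV//; exact: measurable_xsection.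
- have mVT : measurable [set: Om] by exact: measurableT.
  have := @measurable_fun_xsection _ _ _ _ _ (law_on P _ _ mVT mV) _ mD.
  by apply: eq_measurable_fun => x _; rewrite /= /law_on setTI.
Qed.

End freezing.

(** The integral formula for [F] and the one for the sure event differ only by the factor [P F].
    This carries independence of past and future across one step of the dynamics: [Z] is the state,
    [V] the current noise and [F] an event on later noises. *)
Lemma indep_pair {d d1 d2} {Om : measurableType d} {T1 : measurableType d1}
  {T2 : measurableType d2} {R : realType} (P : probability Om R) (A F : set Om)
  (Z : Om -> T1) (V : Om -> T2) :
  measurable A -> measurable F ->
  measurable_fun setT Z -> measurable_fun setT V ->
  (forall C B, measurable C -> measurable B ->
    P (A `&` Z @^-1` C `&` V @^-1` B) = P (A `&` Z @^-1` C) * P (V @^-1` B))%E ->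
  (forall C B, measurable C -> measurable B ->
    P (A `&` Z @^-1` C `&` (F `&` V @^-1` B)) =
    P (A `&` Z @^-1` C) * P (F `&` V @^-1` B))%E ->
  (forall B, measurable B -> P (F `&` V @^-1` B) = P F * P (V @^-1` B))%E ->
  forall D, measurable D ->
  P (A `&` F `&` (fun w => (Z w, V w)) @^-1` D) =
  (P F * P (A `&` (fun w => (Z w, V w)) @^-1` D))%E.
Proof.
move=> mA mF mZ mV iZ iZF iVF D mD.
rewrite (indep_pair_integral P A F Z V mA mF mZ mV)//.
have := indep_pair_integral P A setT Z V mA measurableT mZ mV _ _ D mD.
rewrite setIT probability_setT mul1e => -> //.
- by move=> C B mC mB; rewrite setTI; exact: iZ.
- by move=> B mB; rewrite setTI mul1e.
Qed.

(** The middle term is the integral of the slice probabilities against the law of [Z] on [A], a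
    measure of total mass [P A] carried by [E]. *)
Lemma freezing_bounds {d d1 d2} {Om : measurableType d} {T1 : measurableType d1}
  {T2 : measurableType d2} {R : realType} (P : probability Om R) (A : set Om)
  (Z : Om -> T1) (V : Om -> T2) (E : set T1) (D : set (T1 * T2)) (a b : R) :
  measurable A -> measurable E -> measurable D -> 0 <= a -> 0 <= b ->
  measurable_fun setT Z -> measurable_fun setT V ->
  (forall C B, measurable C -> measurable B ->
    P (A `&` Z @^-1` C `&` V @^-1` B) = P (A `&` Z @^-1` C) * P (V @^-1` B))%E ->
  A `<=` Z @^-1` E ->
  (forall z, E z -> (a%:E <= P (V @^-1` xsection D z) <= b%:E)%E) ->
  (a%:E * P A <= P (A `&` (fun w => (Z w, V w)) @^-1` D) <= b%:E * P A)%E.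
Proof.
move=> mA mE mD a0 b0 mZ mV iZ AE abD.
have intE (c : R) : 0 <= c ->
    (\int[law_on P A Z mA mZ]_x (c%:E * (\1_E x)%:E) = c%:E * P A)%E.
  move=> c0; rewrite ge0_integralZl//; last first.
    by apply/measurable_EFinP; exact: measurable_indic.
  by rewrite integral_indic// setIT /= /law_on setIidl.
(* The slice bounds are known on [E] only. Cutting [D] down to [E] does not change the event,
   because [Z] lies in [E] on [A], and it makes the integrand vanish off [E]. *)
pose D' := D `&` (E `*` setT).
have mD' : measurable D' by apply: measurableI => //; exact: measurableX.
have -> : A `&` (fun w => (Z w, V w)) @^-1` D = A `&` setT `&` (fun w => (Z w, V w)) @^-1` D'.
  rewrite setIT; apply/seteqP; split => w /= [Aw]; last by case.
  by move=> Dw; do 2!split => //; split => //; exact: AE.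
rewrite (indep_pair_integral P A setT Z V mA measurableT mZ mV)//; last 2 first.
- by move=> C B mC mB; rewrite setTI; exact: iZ.
- by move=> B mB; rewrite setTI probability_setT mul1e.
rewrite probability_setT mul1e -!intE//.
have mP : measurable_fun setT (fun x => P (V @^-1` xsection D' x)).
  have := @measurable_fun_xsection _ _ _ _ _ (law_on P _ _ (@measurableT _ Om) mV) _ mD'.
  by apply: eq_measurable_fun => x _; rewrite /= /law_on setTI.
have bnd x : (a%:E * (\1_E x)%:E <= P (V @^-1` xsection D' x) <= b%:E * (\1_E x)%:E)%E.
  rewrite indicE; have [xE|xE] := boolP (x \in E).
    rewrite !mule1; have -> : xsection D' x = xsection D x; last by apply: abD; exact: set_mem.
    rewrite !xsectionE; apply/seteqP; split => y /=; first by case.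
    by move=> ?; split => //; split => //; exact: set_mem.
  rewrite !mule0; have -> : xsection D' x = set0.
    rewrite !xsectionE; apply/seteqP; split => y //= -[_ []] /=.
    by move=> /mem_set; rewrite (negbTE xE).
  by rewrite preimage_set0 measure0 lexx.
have mI (c : R) : measurable_fun setT (fun x => c%:E * (\1_E x)%:E)%E.
  by apply/measurable_EFinP; apply: measurable_funM => //; exact: measurable_indic.
apply/andP; split.
- apply: ge0_le_integral => //.
  + by move=> x _; rewrite lee_fin mulr_ge0.
  + by move=> x _; case/andP: (bnd x).
- apply: ge0_le_integral => //.
  by move=> x _; case/andP: (bnd x).
Qed.

(** * Borel sets of row vectors and preimages under Lipschitz maps *)

Lemma measurable_open_rV {R : realType} {n : nat} (O : set 'rV[R]_n) :
  open O -> measurable (O : set (BorelRV R n)).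
Proof. by move=> oO; exact: sub_sigma_algebra. Qed.

Lemma measurable_closed_rV {R : realType} {n : nat} (O : set 'rV[R]_n) :
  closed O -> measurable (O : set (BorelRV R n)).
Proof.
move=> cO; rewrite -(setCK O); apply: measurableC; apply: measurable_open_rV.
exact: closed_openC.
Qed.

Lemma rat_rV_dense {R : realType} {n : nat} (x : 'rV[R]_n) (e : R) : 0 < e ->
  exists q : 'rV[rat]_n, ball (map_mx ratr q : 'rV[R]_n) e x.
Proof.
move=> e0.
have q_ i : {q : rat | `|ratr q - x 0 i| < e}.
  apply: cid; have /rat_in_itvoo[q] : x 0 i - e < x 0 i + e by rewrite ltrD2l gtrN.
  by rewrite in_itv /= -ltr_distlC distrC => ?; exists q.
exists (\row_i sval (q_ i)); split=> // i j.
rewrite /ball /= ord1 !mxE; exact: svalP (q_ j).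
Qed.

Lemma continuous_linear_form {R : realType} {n : nat} (a : 'rV[R]_n) :
  continuous (fun x : 'rV[R]_n => \sum_(i < n) a 0 i * x 0 i).
Proof.
elim: (index_enum _) => [|i r IHr].
  rewrite (_ : (fun _ => _) = cst 0); first exact: cst_continuous.
  by apply/funext => x; rewrite big_nil.
rewrite (_ : (fun _ => _) = (fun x : 'rV[R]_n => a 0 i * x 0 i) \+
    (fun x : 'rV[R]_n => \sum_(i <- r) a 0 i * x 0 i)); last first.
  by apply/funext => x; rewrite big_cons.
move=> x; have F : Filter (nbhs (x : 'rV[R]_n)) by exact: nbhs_filter.
apply: cvgD; last exact: IHr.
by apply: cvgM; [exact: cvg_cst|exact: coord_continuous].
Qed.

Lemma measurable_convex_polytope {R : realType} {n : nat} (A : set 'rV[R]_n) :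
  convex_polytope A -> measurable (A : set (BorelRV R n)).
Proof.
move=> [_ [k [a [b [strict ->]]]]].
pose H j : set (BorelRV R n) := [set x : 'rV[R]_n | if strict j then \sum_(i < n) a j 0 i * x 0 i < b j
           else \sum_(i < n) a j 0 i * x 0 i <= b j].
rewrite [X in measurable X](_ : _ = \bigcap_(j in [set: 'I_k]) H j); last first.
  by apply/seteqP; split => [x h j _|x h j]; [exact: h|exact: (h j)].
apply: fin_bigcap_measurable => // j _; rewrite /H; case: (strict j).
- apply: measurable_open_rV.
  apply: (open_comp _ (@open_lt _ (b j))) => x _.
  exact: continuous_linear_form.
- apply: measurable_closed_rV.
  apply: (closed_comp _ (@closed_le _ (b j))) => x _.
  exact: continuous_linear_form.
Qed.

(* [U] and [W] need not be measurable, in which case the measurability of [f] on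
   [X `*` U `*` W] is vacuous; the Lipschitz bound still makes the preimages of
   open sets relatively open, i.e. traces of countable unions of rational boxes. *)
Lemma lipschitz3_preimage_trace {R : realType} {n m p : nat}
    {X : set 'rV[R]_n} {U : set 'rV[R]_m} {W : set 'rV[R]_p}
    {f : 'rV[R]_n -> 'rV[R]_m -> 'rV[R]_p -> 'rV[R]_n} :
  lipschitz3 X U W f ->
  forall C : set (BorelRV R n), measurable C ->
  exists2 D : set (BorelRV R n * BorelRV R m * BorelRV R p), measurable D &
    forall x u w, X x -> U u -> W w -> D (x, u, w) <-> C (f x u w).
Proof.
(* Good-sets argument: the sets [C] that admit such a [D] form a sigma-algebra, so only open sets
   need a construction. *)
move=> [K fK]; pose tr := [set C : set 'rV[R]_n |
  exists2 D : set (BorelRV R n * BorelRV R m * BorelRV R p), measurable D &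
    forall x u w, X x -> U u -> W w -> D (x, u, w) <-> C (f x u w)].
suff : <<s open >> `<=` tr by move=> + C mC; exact.
apply: smallest_sub; first split.
- by exists set0.
- move=> C [D mD DC]; exists (~` D); first exact: measurableC.
  by move=> x u w Xx Uu Ww; rewrite setTD /=; split => h h'; apply: h; exact/(DC x u w).
- move=> C_ trC;
  exists (\bigcup_k projT1 (cid2 (trC k))).
    by apply: bigcupT_measurable => k; case: cid2.
  move=> x u w Xx Uu Ww; split => -[k _] h; exists k => //; move: h; case: cid2 => D mD DC /= h;
    exact/(DC x u w Xx Uu Ww).
move=> O oO.
pose I := ('rV[rat]_n * 'rV[rat]_m * 'rV[rat]_p * nat)%type.
pose e (i : I) : R := i.2.+1%:R^-1.
pose box (i : I) : set (BorelRV R n * BorelRV R m * BorelRV R p) :=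
  (ball (map_mx ratr i.1.1.1 : 'rV[R]_n) (e i) `*` ball (map_mx ratr i.1.1.2 : 'rV[R]_m) (e i)) `*`
   ball (map_mx ratr i.1.2 : 'rV[R]_p) (e i).
(* Boxes whose points in the domain of [f] are all sent into [O]; there are countably many, and
   their union is the required [D]. *)
pose good := [set i | forall x u w, X x -> U u -> W w -> box i (x, u, w) -> O (f x u w)].
have mball k (x : 'rV[R]_k) r : measurable (ball x r : set (BorelRV R k)).
  by apply: measurable_open_rV; exact: ball_open.
exists (\bigcup_(i in good) box i).
  rewrite bigcup_mkcond; apply: countable_bigcupT_measurable => [|i].
    exact: countableP.
  by case: ifPn => // _; apply: measurableX; [exact: measurableX|].
move=> x u w Xx Uu Ww; split => [[i]|Of]; first exact.
have [r /= r0 rO] : exists2 r : R, 0 < r & ball (f x u w) r `<=` O.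
  by apply/nbhs_ballP; exact: open_nbhs_nbhs.
have K1 : 0 < 1 + `|K| by rewrite ltr_pwDl.
(* Two points of a box of radius [t] differ by less than [2t] in each of the three components, so
   their images differ by less than [6t(1 + |K|)]. The summand 1 keeps the factor positive whatever
   the sign of [K]. *)
have [k kr] : exists k : nat, k.+1%:R^-1 < r / (6 * (1 + `|K|)).
  have d0 : 0 < r / (6 * (1 + `|K|)) by rewrite divr_gt0// mulr_gt0.
  near \oo => k; exists k; near: k; exact: near_infty_natSinv_lt (PosNum d0).
have e0 : 0 < k.+1%:R^-1 :> R by rewrite invr_gt0.
have [qx hx] := rat_rV_dense x _ e0.
have [qu hu] := rat_rV_dense u _ e0.
have [qw hw] := rat_rV_dense w _ e0.
exists (qx, qu, qw, k) => // x' u' w' Xx' Uu' Ww' [[/= hx' hu'] hw'].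
have close j (q y y' : 'rV[R]_j) : ball q k.+1%:R^-1 y -> ball q k.+1%:R^-1 y' ->
    `|y - y'| < r / (6 * (1 + `|K|)) *+ 2.
  move=> /ball_sym h1 /(ball_triangle h1); rewrite -ball_normE /= => /lt_le_trans; apply.
  by rewrite mulr2n lerD// ltW.
apply: rO; rewrite -ball_normE /=.
apply: le_lt_trans (fK _ _ _ _ _ _ Xx Xx' Uu Uu' Ww Ww') _.
have := close _ _ _ _ hx hx'; have := close _ _ _ _ hu hu'; have := close _ _ _ _ hw hw'.
set a := `|x - x'|; set b := `|u - u'|; set c := `|w - w'|; set t := r / _ => ct bt at_.
have -> : r = (1 + `|K|) * (t *+ 6).
  by rewrite /t; field; rewrite gt_eqF.
have abc0 : 0 <= a + b + c by rewrite !addr_ge0 ?normr_ge0.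
apply: (@le_lt_trans _ _ ((1 + `|K|) * (a + b + c))).
  by apply: ler_wpM2r => //; rewrite (le_trans (ler_norm K))// lerDr.
rewrite ltr_pM2l//; lra.
Unshelve. all: by end_near.
Qed.

(** * Histories of the abstract process and their independence from later noise *)

Section abstract_process.
Context {R : realType} {n m p : nat}.
Variables (X : set 'rV[R]_n) (U : set 'rV[R]_m) (W : set 'rV[R]_p).
Context {d} {Omega : measurableType d}.
Variables (P : probability Omega R) (eta : nat -> Omega -> 'rV[R]_p).
Variables (f : 'rV[R]_n -> 'rV[R]_m -> 'rV[R]_p -> 'rV[R]_n) (xI : 'rV[R]_n).
Variables (pi : nat -> 'rV[R]_n -> 'rV[R]_m).
Context {S : finType}.
Variable (T : 'rV[R]_n -> S).
Hypotheses (XI : X xI) (eta_iid : iid_noise P W eta).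
Hypothesis f_closed : forall x u w, X x -> U u -> W w -> X (f x u w).
Hypothesis f_lip : lipschitz3 X U W f.
Hypothesis mT : forall s, measurable (T @^-1` [set s] : set (BorelRV R n)).
Hypothesis mpi : forall k, measurable_fun setT (pi k : BorelRV R n -> BorelRV R m).
Hypothesis piU : forall k x, U (pi k x).

Local Notation x := (traj f pi eta xI).

Lemma eta_W k w : W (eta k w).
Proof. by case: eta_iid => _ /(_ k w). Qed.

Lemma measurable_eta k : measurable_fun setT (eta k : Omega -> BorelRV R p).
Proof. by case: eta_iid => /(_ k). Qed.

Lemma traj_X k w : X (x k w).
Proof. by elim: k => //= k IHk; apply: f_closed => //; exact: eta_W. Qed.

(** The closed-loop map is controlled only over [X] and [W]. A measurable set agreeing with the
    preimage there is enough, since trajectories stay in [X] and noises in [W]. *)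
Lemma closed_loop_trace k (C : set (BorelRV R n)) : measurable C ->
  exists2 D : set (BorelRV R n * BorelRV R p), measurable D &
    forall y w, X y -> W w -> D (y, w) <-> C (f y (pi k y) w).
Proof.
move=> mC; have [D mD DC] := lipschitz3_preimage_trace f_lip C mC.
exists ((fun yw : BorelRV R n * BorelRV R p =>
   ((yw.1, pi k yw.1 : BorelRV R m), yw.2)) @^-1` D); last first.
  by move=> y w Xy Ww; exact: DC.
apply: measurable_preimageT => //; apply: measurable_fun_pair => //.
apply: measurable_fun_pair => //.
by apply: measurableT_comp => //; exact: mpi.
Qed.

Lemma measurable_traj k : measurable_fun setT (x k : Omega -> BorelRV R n).
Proof.
elim: k => [|k IHk]; first exact: measurable_cst.
move=> _ C mC; rewrite setTI; have [D mD DC] := closed_loop_trace k C mC.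
rewrite (_ : _ @^-1` _ = (fun w => (x k w : BorelRV R n, eta k w : BorelRV R p)) @^-1` D).
  apply: measurable_preimageT => //; apply: measurable_fun_pair => //.
  exact: measurable_eta.
by apply/seteqP; split => w /= h; apply/(DC _ _ (traj_X k w) (eta_W k w)).
Qed.

Definition hist (l : seq S) : set Omega :=
  [set w | mkseq (fun j => T (x j w)) (size l) = l].

Lemma hist_rcons l s :
  hist (rcons l s) = hist l `&` [set w | T (x (size l) w) = s].
Proof.
apply/seteqP; rewrite /hist; split => w /=; rewrite size_rcons mkseqS.
  by move=> /rcons_inj[].
by move=> [-> ->].
Qed.

Lemma measurable_hist l : measurable (hist l).
Proof.
elim/last_ind: l => [|l s IHl].
  by rewrite (_ : hist _ = setT)//; apply/seteqP; split.
rewrite hist_rcons; apply: measurableI => //.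
exact: (measurable_preimageT (x (size l) : Omega -> BorelRV R n) _ (measurable_traj _) (mT s)).
Qed.

(** When [B i] is [setT] for all [i < k], this is an event on the noises from index [k] on. *)
Let fut (N : nat) (B : nat -> set (BorelRV R p)) : set Omega :=
  [set w | forall i, (i < N)%N -> B i (eta i w)].

Let fut_upd (k N : nat) (B : nat -> set (BorelRV R p)) (C : set (BorelRV R p)) :
  (k < N)%N -> B k = setT ->
  fut N B `&` eta k @^-1` C = fut N (fun i => if i == k then C else B i).
Proof.
move=> kN Bk; apply/seteqP; split => w /=.
  by move=> [h Cw] i iN; case: eqP => [->//|_]; exact: h.
move=> h; split; last by have := h k kN; rewrite eqxx.
by move=> i iN; have := h i iN; case: eqP => // -> _; rewrite Bk.
Qed.

Let P_fut_upd (k N : nat) (B : nat -> set (BorelRV R p)) (C : set (BorelRV R p)) :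
  (k < N)%N -> (forall i, measurable (B i)) -> measurable C -> B k = setT ->
  (P (fut N B `&` eta k @^-1` C) = P (fut N B) * P (eta k @^-1` C))%E.
Proof.
move=> kN mB mC Bk; rewrite fut_upd//.
have mB' i : measurable (if i == k then C else B i) by case: ifP.
case: eta_iid => _ _ _ ind; rewrite /fut (ind N _ mB') (ind N _ mB).
rewrite (bigD1 (Ordinal kN))//= eqxx [in RHS](bigD1 (Ordinal kN))//=.
rewrite Bk preimage_setT probability_setT mul1e muleC; congr (_ * _)%E.
by apply: eq_bigr => i; rewrite -val_eqE => /negbTE /= ->.
Qed.

(** Stated for whole blocks of noises, not just [eta k], so that the induction closes: passing from
    [k] to [k.+1] uses independence from [eta k] and the later noises jointly. At [k = 0] the state
    is deterministic, so the past event is sure or impossible. *)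
Lemma hist_indep_future k l (C : set (BorelRV R n)) N (B : nat -> set (BorelRV R p)) :
  size l = k.+1 -> (k < N)%N -> measurable C -> (forall i, measurable (B i)) ->
  (forall i, (i < k)%N -> B i = setT) ->
  (P (hist l `&` x k @^-1` C `&` fut N B) = P (hist l `&` x k @^-1` C) * P (fut N B))%E.
Proof.
elim: k l C N B => [|k IHk] l C N B.
  case: l => [|s [|//]]// _ N0 mC mB _.
  have [h|h] := pselect (T xI = s /\ C xI).
    rewrite (_ : hist _ `&` _ = setT) ?setTI ?probability_setT ?mul1e//.
    by case: h => h1 h2; apply/seteqP; split => w //= _; split => //; rewrite /hist /mkseq /= h1.
  rewrite (_ : hist _ `&` _ = set0) ?set0I ?measure0 ?mul0e//.
  by apply/seteqP; split => w //= -[] [h1 h2]; exact: h.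
case/lastP: l => // l s; rewrite size_rcons => -[szl] kN mC mB BT.
(* The last abstract state and the constraint [C] both concern [x k.+1], so together they become one
   condition [D] on the pair of [x k] and [eta k]. *)
have mCs : measurable (C `&` T @^-1` [set s]) by exact: measurableI.
have [D mD DC] := closed_loop_trace k _ mCs.
have -> : hist (rcons l s) `&` x k.+1 @^-1` C =
    hist l `&` (fun w => (x k w : BorelRV R n, eta k w : BorelRV R p)) @^-1` D.
  rewrite hist_rcons szl; apply/seteqP; split => w /=.
    by move=> [[hl Ts] Cx]; split => //; apply/(DC _ _ (traj_X k w) (eta_W k w)).
  by move=> [hl /(DC _ _ (traj_X k w) (eta_W k w))[]].
have fut1 E : fut k.+1 (fun i => if i == k then E else setT) = eta k @^-1` E.
  apply/seteqP; split => w /= h; first by have := h k (ltnSn k); rewrite eqxx.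
  by move=> i ik; case: eqP => // ->.
have mfut : measurable (fut N B).
  rewrite (_ : fut N B = \bigcap_(i in [set i | (i < N)%N]) eta i @^-1` B i).
    apply: bigcap_measurableType => i _.
    exact: measurable_preimageT (measurable_eta i) (mB i).
  by apply/seteqP; split.
rewrite setIAC muleC; apply: indep_pair => //.
- exact: measurable_hist.
- exact: measurable_traj.
- exact: measurable_eta.
- move=> C' B' mC' mB'; rewrite -fut1; apply: IHk => //.
    by move=> i; case: ifP.
  by move=> i ik; rewrite ltn_eqF.
(* The block leaves [eta k] free, so a constraint on it can be absorbed into the block before the
   induction hypothesis is applied. *)
- move=> C' B' mC' mB'; rewrite fut_upd//; [|exact: ltnW|exact: BT].
  apply: IHk => //; first exact: ltnW.
    by move=> i; case: ifP.
  by move=> i ik; rewrite ltn_eqF// BT// ltnW.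
- by move=> B' mB'; apply: P_fut_upd => //; [exact: ltnW|exact: BT].
Qed.

Lemma hist_indep_noise k l (C : set (BorelRV R n)) (B : set (BorelRV R p)) :
  size l = k.+1 -> measurable C -> measurable B ->
  (P (hist l `&` x k @^-1` C `&` eta k @^-1` B) =
   P (hist l `&` x k @^-1` C) * P (eta k @^-1` B))%E.
Proof.
move=> szl mC mB; have -> : eta k @^-1` B = fut k.+1 (fun i => if i == k then B else setT).
  apply/seteqP; split => w /= h; last by have := h k (ltnSn k); rewrite eqxx.
  by move=> i ik; case: eqP => // ->.
apply: hist_indep_future => //; first by move=> i; case: ifP.
by move=> i ik; rewrite ltn_eqF.
Qed.

(** On the history [rcons l s], the state at time [size l] lies in the region of [s] and is
    independent of the noise at that time; freezing it leaves the one-step probability. The bound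
    assumed for [eta 0] transfers because the noises are identically distributed. *)
Lemma hist_step_bounds l s s' (a b : R) : 0 <= a -> 0 <= b ->
  (forall y, T y = s -> X y /\
    (a%:E <= P [set w | T (f y (pi (size l) y) (eta 0%N w)) = s'] <= b%:E)%E) ->
  (a%:E * P (hist (rcons l s)) <= P (hist (rcons (rcons l s) s'))
   <= b%:E * P (hist (rcons l s)))%E.
Proof.
move=> a0 b0 ab; set k := size l; have [D mD DC] := closed_loop_trace k _ (mT s').
rewrite (hist_rcons (rcons l s)) size_rcons -/k.
rewrite (_ : [set w | T (x k.+1 w) = s'] =
    (fun w => (x k w : BorelRV R n, eta k w : BorelRV R p)) @^-1` D); last first.
  by apply/seteqP; split => w /= h; apply/(DC _ _ (traj_X k w) (eta_W k w)).
apply: (freezing_bounds P _ (x k : Omega -> BorelRV R n) (eta k : Omega -> BorelRV R p)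
  (T @^-1` [set s] : set (BorelRV R n))) => //.
- exact: measurable_hist.
- exact: measurable_traj.
- exact: measurable_eta.
- by move=> C B mC mB; apply: hist_indep_noise => //; rewrite size_rcons.
- by move=> w; rewrite hist_rcons => -[].
- move=> y /ab[Xy]; case: eta_iid => _ _ eta_id _.
  rewrite eta_id; last exact: measurable_xsection.
  rewrite (_ : _ @^-1` _ = [set w | T (f y (pi k y) (eta 0%N w)) = s'])//.
  apply/seteqP; split => w /=; rewrite xsectionE /= => h;
    by apply/(DC _ _ Xy (eta_W 0 w)).
Qed.

Lemma hist_total l : (P (hist l) = \sum_(s : S) P (hist (rcons l s)))%E.
Proof.
rewrite (fsbig_seq _ _ (index_enum_uniq S)) -measure_fin_bigcup//=.
- congr (P _); apply/seteqP; split => w; last by move=> [s _]; rewrite hist_rcons => -[].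
  move=> hw; exists (T (x (size l) w)) => /=; first exact: mem_index_enum.
  by rewrite hist_rcons.
- by move=> s s' _ _ [w []]; rewrite !hist_rcons => -[_ /= ->] [_ /= ->].
- by move=> s _; exact: measurable_hist.
Qed.

Lemma le_hist_rcons l s : (P (hist (rcons l s)) <= P (hist l))%E.
Proof.
apply: le_measure; rewrite ?inE; [exact: measurable_hist..|].
by rewrite hist_rcons => w [].
Qed.

End abstract_process.

(** * The adversary playing conditional laws, and the comparison of path laws *)

Theorem theorem1 (R : realType) (n m p : nat)
    (X : set 'rV[R]_n) (U : set 'rV[R]_m) (W : set 'rV[R]_p)
    (d : measure_display) (Omega : measurableType d) (P : probability Omega R)
    (eta : nat -> Omega -> 'rV[R]_p)
    (f : 'rV[R]_n -> 'rV[R]_m -> 'rV[R]_p -> 'rV[R]_n)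
    (Y : finType) (g : 'rV[R]_n -> {set Y}) (xI : 'rV[R]_n)
    (v : nat) (reg : 'I_v -> set 'rV[R]_n) (T : 'rV[R]_n -> option 'I_v)
    (J : nat) (Ubar : 'I_J -> set 'rV[R]_m) (ubar : 'I_J -> 'rV[R]_m)
    (Act : finType) (enabled : option 'I_v -> {set Act})
    (plo phi : option 'I_v -> Act -> option 'I_v -> R)
    (L : option 'I_v -> {set Y})
    (I : option 'I_v -> Act -> 'rV[R]_n -> 'rV[R]_m)
    (sigma : nat -> option 'I_v -> Act)
    (pi : nat -> 'rV[R]_n -> 'rV[R]_m)
    (spec : set (nat -> {set Y})) :
  (* the stochastic system S *)
  compact X -> X xI ->
  iid_noise P W eta ->
  (forall x u w, X x -> U u -> W w -> X (f x u w)) ->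
  lipschitz3 X U W f ->
  measurable_fun ((X : set (BorelRV R n)) `*` (U : set (BorelRV R m)) `*` (W : set (BorelRV R p)))
    (fun t : BorelRV R n * BorelRV R m * BorelRV R p =>
       (f t.1.1 t.1.2 t.2 : BorelRV R n)) ->
  (* the state-space partition and the abstraction map T *)
  (forall i j, i != j -> reg i `&` reg j = set0) ->
  \bigcup_(i in setT) reg i = X ->
  (forall i, convex_polytope (reg i)) ->
  (forall x i, T x = Some i <-> reg i x) ->
  (forall x, T x = None <-> ~ X x) ->
  (* the input-space partition with representatives *)
  (forall j k, j != k -> Ubar j `&` Ubar k = set0) ->
  \bigcup_(j in setT) Ubar j = U ->
  (forall j, Ubar j (ubar j)) ->
  (* interface functions I_{s,a} : T^-1(s) -> ubar *)
  (forall s a x, a \in enabled s -> T x = s -> exists j, I s a x = ubar j) ->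
  (* IMDP interval bounds given by min / max of psi over the regions *)
  (forall i a s', a \in enabled (Some i) ->
     is_min_on (T @^-1` [set Some i])
       (fun x => psi P f (eta 0%N) T I x (T @^-1` [set s']) a) (plo (Some i) a s')%:E /\
     is_max_on (T @^-1` [set Some i])
       (fun x => psi P f (eta 0%N) T I x (T @^-1` [set s']) a) (phi (Some i) a s')%:E) ->
  (* well-formedness of the IMDP: every P(s,a) is nonempty *)
  (forall s a, a \in enabled s -> exists mu, in_Pset plo phi s a mu) ->
  (* label preservation *)
  (forall x, X x -> L (T x) = g x) ->
  (* Markovian scheduler of the IMDP *)
  (forall k s, sigma k s \in enabled s) ->
  (* pi is a (measurable, U-valued) Markovian policy refined from sigma *)
  (forall k, measurable_fun setT (pi k : BorelRV R n -> BorelRV R m)) ->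
  (forall k x, U (pi k x)) ->
  (forall k x, X x -> pi k x = I (T x) (sigma k (T x)) x) ->
  (* measurable specification *)
  <<s @path_cyl {set Y} >> spec ->
  (ereal_inf (imdp_values (T xI) enabled plo phi L sigma spec)
   <= P [set w | spec (fun k => g (traj f pi eta xI k w))])%E.
Proof.
move=> cX XI iid fX flip _ _ regX polyreg TS TN _ _ _ _ bounds nonempty LT sigma_en.
move=> mpi piU pi_ref _.
have mreg i : measurable (reg i : set (BorelRV R n)).
  exact: measurable_convex_polytope (polyreg i).
have mT s : measurable (T @^-1` [set s] : set (BorelRV R n)).
  case: s => [i|].
    rewrite [X in measurable X](_ : _ = reg i)//.
    by apply/seteqP; split => x /= /TS.
  rewrite [X in measurable X](_ : _ = ~` \bigcup_(i in setT) reg i).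
    by apply: measurableC; exact: fin_bigcup_measurable.
  by rewrite regX; apply/seteqP; split => x /= /TN.
pose x := traj f pi eta xI.
have Xx k w : X (x k w) by exact: (traj_X X U W P).
pose H := hist eta f xI pi T.
have mH l : measurable (H l) by exact: (measurable_hist X U W P).
pose pr l : R := fine (P (H l)).
have prE l : P (H l) = (pr l)%:E by rewrite fineK// fin_num_measure.
have pr_ge0 l : 0 <= pr l by rewrite fine_ge0.
have pr_total l : pr l = \sum_s pr (rcons l s).
  have := hist_total X U W P eta f xI pi T XI iid fX flip mT mpi piU l.
  rewrite -/H prE; under eq_bigr do rewrite prE.
  by rewrite sumEFin => -[].
have pr_rcons0 l s : pr l = 0 -> pr (rcons l s) = 0.
  move=> l0; apply/eqP; rewrite eq_le pr_ge0 andbT -lee_fin -prE.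
  apply: (le_trans (le_hist_rcons X U W P eta f xI pi T XI iid fX flip mT mpi piU l s)).
  by rewrite -/H prE l0.
(* The state outside [X] is never reached, so interval bounds on the regions alone will suffice for
   the conditional laws. *)
have prN l : pr (rcons l None) = 0.
  rewrite /pr (_ : H _ = set0) ?measure0//.
  apply/seteqP; split => w //; rewrite /H hist_rcons => -[_ /= /TN].
  by apply; exact: Xx.
have [mu0 mu0P] : exists mu0 : option 'I_v -> Act -> option 'I_v -> R,
    forall s a, a \in enabled s -> in_Pset plo phi s a (mu0 s a).
  have /choice[g0 g0P] : forall sa : option 'I_v * Act, exists mu : option 'I_v -> R,
      sa.2 \in enabled sa.1 -> in_Pset plo phi sa.1 sa.2 mu.
    move=> [s a] /=; have [/nonempty[mu muP]|] := boolP (a \in enabled s); first by exists mu.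
    by exists (fun=> 0).
  by exists (fun s a => g0 (s, a)) => s a; exact: (g0P (s, a)).
(* The history [h] excludes the current state [s], so the current time is [size h]. The conditional
   law is compatible only with the scheduled action; any other action gets the default [mu0]. *)
pose Adv h s a s' : R :=
  if (pr (rcons h s) != 0) && (a == sigma (size h) s)
  then pr (rcons (rcons h s) s') / pr (rcons h s) else mu0 s a s'.
have Adv_adv : adversary enabled plo phi Adv.
  move=> h s a a_en; rewrite /Adv.
  case: (boolP (_ && _)) => [/andP[pr0 /eqP a_sigma]|_]; last exact: mu0P.
  case: s => [i|] in a_en a_sigma pr0 *; last by rewrite prN eqxx in pr0.
  have pr_gt0 : 0 < pr (rcons h (Some i)) by rewrite lt_neqAle eq_sym pr0 pr_ge0.
  split => [s'||s'].
  - by rewrite divr_ge0.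
  - by rewrite -mulr_suml -pr_total divff.
  have [[[y Ty plo_eq] plo_le] [_ phi_ge]] := bounds i a s' a_en.
  have plo0 : 0 <= plo (Some i) a s' by rewrite -lee_fin -plo_eq measure_ge0.
  have phi0 : 0 <= phi (Some i) a s'.
    by rewrite -lee_fin; apply: le_trans (phi_ge y Ty); exact: measure_ge0.
  (* As [a] is the scheduled action, refinement identifies the input [pi (size h) z] with the
     interface value, and the one-step probability with [psi]. *)
  have step z : T z = Some i -> X z /\
      ((plo (Some i) a s')%:E <= P [set w | T (f z (pi (size h) z) (eta 0%N w)) = s']
       <= (phi (Some i) a s')%:E)%E.
    move=> Tz; have Xz : X z by apply: contrapT => /TN; rewrite Tz.
    split => //; rewrite pi_ref// Tz -a_sigma; apply/andP; split.
      by have := plo_le z Tz; rewrite /psi Tz.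
    by have := phi_ge z Tz; rewrite /psi Tz.
  have := hist_step_bounds X U W P eta f xI pi T XI iid fX flip mT mpi piU
    h (Some i) s' _ _ plo0 phi0 step.
  by rewrite -/H !prE -!EFinM !lee_fin ler_pdivlMr// ler_pdivrMr.
pose tr (w : Omega) : path_space v := fun k => T (x k w).
have mtr : measurable_fun setT tr.
  refine (@measurability _ _ _ _ setT (tr : _ -> path_space v) (@path_cyl (option 'I_v)) _ _) => //.
  move=> _ [_ [k [s ->]] <-]; rewrite setTI.
  apply: (measurable_preimageT (x k : Omega -> BorelRV R n) _ _ (mT s)).
  exact: (measurable_traj X U W P).
pose trX : {mfun Omega >-> path_space v} := HB.pack tr (isMeasurableFun.Build _ _ _ _ tr mtr).
(* The path measure is the law of the abstract trajectory; label preservation turns the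
   specification event into the one for the system. *)
apply: ereal_inf_lbound; exists Adv, (distribution P trX); split => //; last first.
  congr (P _); apply/seteqP; split => w /=; rewrite /tr.
    by rewrite (_ : (fun k => g _) = (fun k => L (T (x k w))))//; apply/funext => k; rewrite LT.
  by rewrite (_ : (fun k => g _) = (fun k => L (T (x k w))))//; apply/funext => k; rewrite LT.
move=> k h.
have H_mkseq w : H (mkseq h k.+1) w <-> forall i, (i <= k)%N -> T (x i w) = h i.
  rewrite /H /hist size_mkseq; split => [hw i ik|hw].
    have := congr1 (fun l => nth None l i) hw.
    by rewrite !nth_mkseq.
  apply: (@eq_from_nth _ None); rewrite !size_mkseq// => i ik.
  by rewrite !nth_mkseq//; exact: hw.
transitivity (P (H (mkseq h k.+1))).
  by congr (P _); apply/seteqP; split => w /H_mkseq.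
(* Chain rule: the product of conditional probabilities telescopes to the probability of the
   history. *)
rewrite prE; congr (_%:E); elim: k {H_mkseq} => [|k IHk].
  rewrite big_ord0 mulr1 /pr; case: eqP => h0.
    rewrite (_ : H _ = setT) ?probability_setT//.
    by apply/seteqP; split => w // _; rewrite /H /hist /mkseq /= h0.
  rewrite (_ : H _ = set0) ?measure0//.
  by apply/seteqP; split => w //=; rewrite /H /hist /mkseq /= => -[] /esym.
rewrite big_ord_recr /= mulrA -IHk -/(mkseq h k) /Adv size_mkseq eqxx andbT -mkseqS.
(* After a null prefix both sides are zero, whatever the default distribution is. *)
rewrite [in LHS]mkseqS; have [pr0|] := eqVneq (pr (mkseq h k.+1)) 0.
  by rewrite pr_rcons0// pr0 mul0r.
by move=> pr0; rewrite mulrCA divff// mulr1.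
Qed.
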